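(* Assume that the KKT solution set $\Omega^*$ is nonempty and that $\mathcal P_f\succeq0$, $\mathcal P_g\succeq0$, $\mathcal P_f+\sigma A^*A\succ0$, $\mathcal P_g+\sigma B^*B\succ0$. Let $\beta\in(0,1]$ be such that for every $w_1,w_2\in\mathbb H$, with $\Delta w:=w_1-w_2$ and $\Delta\mathcal F_{sm}:=\mathcal F_{sm}(w_1)-\mathcal F_{sm}(w_2)$, $$\Delta\mathcal F_{sm}\in\operatorname{Im}(\mathcal M)\qquad\text{and}\qquad\langle\Delta\mathcal F_{sm},\Delta w\rangle\ge\frac1{2\beta}\|\Delta\mathcal F_{sm}\|_{\mathcal M^\dagger}^2 .$$ Then, for all $w_1,w_2\in\mathbb H$, $$\|\mathbf Tw_1-\mathbf Tw_2\|_{\mathcal M}^2\le\|w_1-w_2\|_{\mathcal M}^2-(1-\beta)\|(I-\mathbf T)w_1-(I-\mathbf T)w_2\|_{\mathcal M}^2 .$$ In particular, $\mathbf T$ is nonexpansive in the $\mathcal M$-seminorm, including at the endpoint $\beta=1$.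
   Context: **Setting.** $\mathbb X,\mathbb Y,\mathbb Z$ are finite-dimensional Euclidean spaces, each with an inner product $\langle\cdot,\cdot\rangle$ and induced norm $\|\cdot\|$; $\mathbb H:=\mathbb Y\times\mathbb Z\times\mathbb X$ carries the product inner product, with elements $w=(y,z,x)$. $p:\mathbb Y\to(-\infty,+\infty]$ and $q:\mathbb Z\to(-\infty,+\infty]$ are closed proper convex; $f:\mathbb Y\to\mathbb R$ and $g:\mathbb Z\to\mathbb R$ are convex and differentiable with Lipschitz continuous gradients; $A:\mathbb Y\to\mathbb X$, $B:\mathbb Z\to\mathbb X$ are linear with adjoints $A^*,B^*$; $c\in\mathbb X$. The problem is $\min_{y,z}\ p(y)+f(y)+q(z)+g(z)$ subject to $Ay+Bz=c$. For a self-adjoint linear operator $\Sigma$, $\|v\|_\Sigma^2:=\langle v,\Sigma v\rangle$; $\Sigma\succeq0$ (resp. $\succ0$) means positive semidefinite (resp. definite); $\operatorname{Im}(\Sigma)$ is the range and $\Sigma^\dagger$ the Moore--Penrose pseudoinverse. **Majorization.** $\widehat\Sigma_f$ on $\mathbb Y$ and $\widehat\Sigma_g$ on $\mathbb Z$ are self-adjoint positive semidefinite linear operators such that for all $y,y'\in\mathbb Y$, $z,z'\in\mathbb Z$: $f(y)\le f(y')+\langle\nabla f(y'),y-y'\rangle+\tfrac12\|y-y'\|_{\widehat\Sigma_f}^2$ and $g(z)\le g(z')+\langle\nabla g(z'),z-z'\rangle+\tfrac12\|z-z'\|_{\widehat\Sigma_g}^2$. Let $\sigma>0$, let $\mathcal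 S$ on $\mathbb Y$ and $\mathcal T$ on $\mathbb Z$ be self-adjoint linear operators (not necessarily semidefinite), and set $\mathcal P_f:=\mathcal S+\widehat\Sigma_f$, $\mathcal P_g:=\mathcal T+\widehat\Sigma_g$. **Operators on $\mathbb H$.** With $\partial$ the convex subdifferential, $$\mathcal R_{ns}(w)=\begin{pmatrix}\partial p(y)+A^*x\\ \partial q(z)+B^*x\\ -Ay-Bz+c\end{pmatrix},\quad \mathcal F_{sm}(w)=\begin{pmatrix}\nabla f(y)\\ \nabla g(z)\\ 0\end{pmatrix},\quad \mathcal R=\mathcal R_{ns}+\mathcal F_{sm},$$ $$\mathcal M=\begin{pmatrix}\mathcal P_f+\sigma A^*A&0&A^*\\ 0&\mathcal P_g&0\\ A&0&\sigma^{-1}I\end{pmatrix}.$$ Under the stated hypotheses $\mathcal M\succeq0$ (possibly singular), so $\|w\|_{\mathcal M}=\langle w,\mathcal Mw\rangle^{1/2}$ is a seminorm. The KKT solution set is $\Omega^*:=\{w\in\mathbb H:0\in\mathcal R_{ns}(w)+\mathcal F_{sm}(w)\}$. **The mapping $\mathbf T=(\mathcal M+\mathcal R_{ns})^{-1}(\mathcal M-\mathcal F_{sm})$.** $\mathbf T(w)$ is the point $w^+\in\mathbb H$ with $\mathcal Mw-\mathcal F_{sm}(w)\in\mathcal Mw^++\mathcal R_{ns}(w^+)$; under the stated positive (semi)definiteness hypotheses such a $w^+$ exists and is unique for every $w\in\mathbb H$, so $\mathbf T:\mathbb H\to\mathbb H$ is well defined. *)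

(* Defs.v *)
From HB Require Import structures.
From mathcomp Require Import all_boot all_order all_algebra.
From mathcomp Require Import all_classical all_reals all_analysis.
Set Implicit Arguments.
Unset Strict Implicit.
Unset Printing Implicit Defensive.
Import Order.TTheory GRing.Theory Num.Theory.
Import numFieldNormedType.Exports.
Local Open Scope classical_set_scope.
Local Open Scope ring_scope.

(* Finite-dimensional real inner product spaces, normed by the inner product. *)
HB.mixin Record NormedVector_isEuclidean (R : realType) E
    of NormedModule R E & Vector R E := {
  inner : {dot E for idfun};
  inner_normE : forall v : E, `|v| ^+ 2 = inner v v
}.

#[short(type="euclideanType")]
HB.structure Definition Euclidean (R : realType) :=
  {E of NormedModule R E & Vector R E & NormedVector_isEuclidean R E}.

Section Operators.
Context {R : realType}.

(* The form is a parameter because these are used on Y, Z and on Y * Z * X,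
   whose library norm is not the Euclidean one. *)
Definition self_adjoint (E : Type) (ip : E -> E -> R) (L : E -> E) : Prop :=
  forall u v, ip (L u) v = ip u (L v).

Definition normsq (E : Type) (ip : E -> E -> R) (L : E -> E) (v : E) : R :=
  ip v (L v).

Definition seminorm (E : Type) (ip : E -> E -> R) (L : E -> E) (v : E) : R :=
  Num.sqrt (normsq ip L v).

Definition psd (E : Type) (ip : E -> E -> R) (L : E -> E) : Prop :=
  forall v, 0 <= normsq ip L v.

Definition posdef (E : zmodType) (ip : E -> E -> R) (L : E -> E) : Prop :=
  forall v, v != 0 -> 0 < normsq ip L v.

(* The four Penrose equations; they determine the linear map N uniquely. *)
Definition moore_penrose (E : Type) (ip : E -> E -> R) (L N : E -> E) : Prop :=
  [/\ forall v, L (N (L v)) = L v, forall v, N (L (N v)) = N v,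
      self_adjoint ip (fun v => L (N v)) & self_adjoint ip (fun v => N (L v))].

Definition adjoint_of (U V : euclideanType R) (L : U -> V) (Ls : V -> U) : Prop :=
  forall u v, inner (L u) v = inner u (Ls v).

End Operators.

Section ConvexAnalysis.
Context {R : realType} {E : euclideanType R}.

Definition proper (p : E -> \bar R) : Prop :=
  (forall v, p v != -oo%E) /\ (exists v, p v != +oo%E).

(* Meant for functions that avoid -oo; the convention 0 * +oo = 0 makes the
   endpoints t = 0 and t = 1 harmless. *)
Definition econvex (p : E -> \bar R) : Prop :=
  forall (t : R) u v, 0 <= t <= 1 ->
    (p (t *: u + (1 - t) *: v)%R <= t%:E * p u + (1 - t)%:E * p v)%E.

Definition closed_proper_convex (p : E -> \bar R) : Prop :=
  [/\ lower_semicontinuous p, proper p & econvex p].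

Definition subdiff (p : E -> \bar R) (u : E) : set E :=
  [set s | forall v, (p u + (inner s (v - u)%R)%:E <= p v)%E].

Definition has_gradient (f : E -> R) (gradf : E -> E) : Prop :=
  forall u, differentiable f u /\ forall v, 'd f u v = inner (gradf u) v.

Definition majorized (f : E -> R) (gradf : E -> E) (Sigma : E -> E) : Prop :=
  forall u v, f u <= f v + inner (gradf v) (u - v)
                     + 2^-1 * normsq inner Sigma (u - v).

End ConvexAnalysis.

Section KKT.
Context {R : realType} {Y Z X : euclideanType R}.
Local Notation H := (Y * Z * X)%type.

Definition innerH (u v : H) : R :=
  inner u.1.1 v.1.1 + inner u.1.2 v.1.2 + inner u.2 v.2.

Definition Rns (p : Y -> \bar R) (q : Z -> \bar R) (A : 'Hom(Y, X))
    (B : 'Hom(Z, X)) (As : 'Hom(X, Y)) (Bs : 'Hom(X, Z)) (c : X) (w : H) : set H :=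
  [set r | [/\ [set s + As w.2 | s in subdiff p w.1.1] r.1.1,
               [set s + Bs w.2 | s in subdiff q w.1.2] r.1.2 &
               r.2 = - A w.1.1 - B w.1.2 + c]].

Definition Fsm (gradf : Y -> Y) (gradg : Z -> Z) (w : H) : H :=
  (gradf w.1.1, gradg w.1.2, 0).

Definition Mop (sigma : R) (Pf : 'End(Y)) (Pg : 'End(Z)) (A : 'Hom(Y, X))
    (As : 'Hom(X, Y)) (w : H) : H :=
  (Pf w.1.1 + sigma *: As (A w.1.1) + As w.2,
   Pg w.1.2,
   A w.1.1 + sigma^-1 *: w.2).

Definition kkt_set (rns : H -> set H) (fsm : H -> H) : set H :=
  [set w | [set r + fsm w | r in rns w] 0].

(* T = (M + Rns)^-1 (M - Fsm) *)
Definition is_mapping_T (M : H -> H) (rns : H -> set H) (fsm T : H -> H) : Prop :=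
  forall w, [set M (T w) + r | r in rns (T w)] (M w - fsm w).

End KKT.

(* Main.v *)
(* Write d := w1 - w2, d' := T w1 - T w2, e := d - d' and D := Fsm w1 - Fsm w2.
   Monotonicity of Rns gives <M e, d'> >= <D, d'> = <D, d> - <D, e>.  If D = M u,
   then |D|^2 in the M^dagger seminorm is |u|_M^2, so cocoercivity bounds <D, d>
   below by |u|_M^2 / (2 beta), while Young's inequality bounds <M u, e> above by
   |u|_M^2 / (2 beta) + (beta / 2) |e|_M^2.  Hence 2 <M e, d'> >= - beta |e|_M^2,
   and expanding |d' + e|_M^2 concludes. *)
From HB Require Import structures.
Require Import Defs.
From mathcomp Require Import all_boot all_order all_algebra.
From mathcomp Require Import all_classical all_reals all_analysis.
From mathcomp Require Import ring lra.
Import Order.TTheory GRing.Theory Num.Theory.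
Import numFieldNormedType.Exports.
Local Open Scope classical_set_scope.
Local Open Scope ring_scope.

Lemma subrACA {V : zmodType} (x y z t : V) : x - y - (z - t) = x - z - (y - t).
Proof. by rewrite !opprD addrACA. Qed.

Section InnerProduct.
Set Implicit Arguments.
Unset Strict Implicit.
Context {R : realType} {Y Z X : euclideanType R}.

Lemma innerC {E : euclideanType R} (u v : E) : inner u v = inner v u.
Proof. by rewrite hermC expr0 mul1r. Qed.

(** Bilinearity makes [innerH] a [biscalar] form, which is the interface of the contraction estimate
    below; the product space enters there only as a linear space with a symmetric form. *)
Lemma innerH_bilinear :
  bilinear_for (GRing.Scale.Law.clone _ _ *%R _)
    (GRing.Scale.Law.clone _ _ *%R _) (@innerH R Y Z X).
Proof.
split=> w a u v /=; rewrite /innerH /= ?linearPl ?linearPr /=; ring.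
Qed.

HB.instance Definition _ := bilinear_isBilinear.Build R
  (Y * Z * X)%type (Y * Z * X)%type R _ _ (@innerH R Y Z X) innerH_bilinear.

Lemma innerHC (u v : Y * Z * X) : innerH u v = innerH v u.
Proof. by rewrite /innerH !(innerC u.1.1, innerC u.1.2, innerC u.2). Qed.

End InnerProduct.

Section Contraction.
Set Implicit Arguments.
Unset Strict Implicit.
Context {R : realType} {E : lmodType R}.
Variables (ip : {biscalar E}) (M : {linear E -> E}).
Hypotheses (ipC : forall u v, ip u v = ip v u).
Hypotheses (M_sa : self_adjoint ip M) (M_psd : psd ip M).

Lemma normsq_sub (u v : E) :
  normsq ip M (u - v) = normsq ip M u - 2 * ip (M u) v + normsq ip M v.
Proof.
rewrite /normsq linearB !linearBr !linearBl -(M_sa u v) (ipC v (M u)); ring.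
Qed.

(** The gap between the two sides is |u - b v|_M^2 / (2 b), so semidefiniteness suffices and [M] may
    be singular. *)
Lemma young_normsq (u v : E) (b : R) : 0 < b ->
  ip (M u) v <= (2 * b)^-1 * normsq ip M u + b / 2 * normsq ip M v.
Proof.
move=> b0; have := M_psd (u - b *: v); rewrite normsq_sub.
have -> : normsq ip M (b *: v) = b ^+ 2 * normsq ip M v.
  by rewrite /normsq linearZ linearZl_LR linearZr_LR mulrA.
rewrite linearZr_LR /= => h.
have -> : (2 * b)^-1 * normsq ip M u + b / 2 * normsq ip M v =
  ip (M u) v + (2 * b)^-1 * (normsq ip M u - 2 * (b * ip (M u) v) +
                b ^+ 2 * normsq ip M v).
  by field; rewrite gt_eqF.
by rewrite lerDl mulr_ge0 // invr_ge0 mulr_ge0 // ltW.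
Qed.

(** The analytic core, freed from the splitting: [d] and [d'] stand for the differences of inputs
    and outputs, [D] for that of the smooth part, and the last premise is what monotonicity of [Rns]
    supplies. *)
Lemma cocoercive_step_contraction (N : E -> E) (b : R) (d d' D : E) :
  moore_penrose ip M N -> 0 < b -> range M D ->
  (2 * b)^-1 * normsq ip N D <= ip D d ->
  0 <= ip (M (d - d') - D) d' ->
  normsq ip M d' <= normsq ip M d - (1 - b) * normsq ip M (d - d').
Proof.
move=> [MNM _ _ _] b0 [u _ <-].
(* Self-adjointness and the Penrose equation M N M = M give <M u, N M u> = <u, M N M u> = <u, M
   u>. *)
have -> : normsq ip N (M u) = normsq ip M u by rewrite /normsq M_sa MNM.
move=> coco; rewrite linearBl subr_ge0 => mono.
have young := young_normsq u (d - d') b0; rewrite linearBr in young.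
(* Moves [M] onto e = d - d' by symmetry, then splits d = e + d'. *)
have e : ip (M d) (d - d') = normsq ip M (d - d') + ip (M (d - d')) d'.
  by rewrite (ipC _ d') -M_sa /normsq -M_sa -linearDl -linearD subrK.
have := normsq_sub d (d - d'); rewrite subKr e => ->.
(* The |u|_M^2 terms of [coco] and [young] cancel; with [mono] this leaves 2 <M e, d'> >= - b
   |e|_M^2, which is the goal after the expansion of |d - e|_M^2. *)
nra.
Qed.

End Contraction.

Section Monotonicity.
Set Implicit Arguments.
Unset Strict Implicit.
Context {R : realType}.

(** Add the subgradient inequalities at [u] and at [v]; the values of [p] cancel once they are known
    to be finite. *)
Lemma subdiff_monotone (E : euclideanType R) (p : E -> \bar R) (u v s t : E) :
  Defs.proper p -> subdiff p u s -> subdiff p v t -> 0 <= inner (s - t) (u - v).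
Proof.
move=> [pNy [a pa]] us vt.
(* If [p x] were +oo, the subgradient inequality tested at [a] would force [p a] = +oo. *)
have fin x r : subdiff p x r -> p x \is a fin_num.
  move=> /(_ a); rewrite fin_numE pNy /=; case: (p x) => //=.
  by rewrite addye // leye_eq (negbTE pa).
move: (us v) (vt u).
rewrite -(fineK (fin _ _ us)) -(fineK (fin _ _ vt)) -!EFinD !lee_fin.
rewrite -(opprB u v) linearNr linearBl => h1 h2; lra.
Qed.

(** The coupling (As x, Bs x, - A y - B z) is skew, so it contributes zero to the product, and [c]
    cancels in the difference; only the two subdifferential terms survive. *)
Lemma Rns_monotone (Y Z X : euclideanType R) (p : Y -> \bar R)
    (q : Z -> \bar R) (A : 'Hom(Y, X)) (B : 'Hom(Z, X)) (As : 'Hom(X, Y))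
    (Bs : 'Hom(X, Z)) (c : X) (w1 w2 r1 r2 : Y * Z * X) :
  Defs.proper p -> Defs.proper q -> adjoint_of A As -> adjoint_of B Bs ->
  Rns p q A B As Bs c w1 r1 -> Rns p q A B As Bs c w2 r2 ->
  0 <= innerH (r1 - r2) (w1 - w2).
Proof.
move=> hp hq hA hB [[s1 ps1 e1] [t1 qt1 f1] g1] [[s2 ps2 e2] [t2 qt2 f2] g2].
have m1 := subdiff_monotone hp ps1 ps2; have m2 := subdiff_monotone hq qt1 qt2.
suff -> : innerH (r1 - r2) (w1 - w2) =
    inner (s1 - s2) (w1.1.1 - w2.1.1) + inner (t1 - t2) (w1.1.2 - w2.1.2).
  exact: addr_ge0.
rewrite /innerH /=.
have -> : r1.1.1 - r2.1.1 = s1 - s2 + As (w1.2 - w2.2).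
  by rewrite -e1 -e2 opprD addrACA -linearB.
have -> : r1.1.2 - r2.1.2 = t1 - t2 + Bs (w1.2 - w2.2).
  by rewrite -f1 -f2 opprD addrACA -linearB.
have -> : r1.2 - r2.2 = - A (w1.1.1 - w2.1.1) - B (w1.1.2 - w2.1.2).
  rewrite g1 g2 (opprD _ c) addrACA subrr addr0 (linearB A) (linearB B).
  by rewrite subrACA (opprD (A _)).
rewrite !linearDl !linearNl /= hA hB !(innerC (As _)) !(innerC (Bs _)).
ring.
Qed.

End Monotonicity.

Section MetricOperator.
Set Implicit Arguments.
Unset Strict Implicit.
Context {R : realType} {Y Z X : euclideanType R}.
Variables (sigma : R) (Pf : 'End(Y)) (Pg : 'End(Z)).
Variables (A : 'Hom(Y, X)) (As : 'Hom(X, Y)).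
Local Notation M := (Mop sigma Pf Pg A As).

Lemma Mop_linear : linear M.
Proof.
move=> a u v; rewrite /Mop /=; congr (_, _, _) => /=.
- rewrite (linearP A) (linearP Pf) !(linearP As) !scalerDr !scalerA.
  by rewrite (mulrC sigma) (addrACA (a *: _)) (addrACA (_ + _)).
- exact: linearP.
- by rewrite (linearP A) !scalerDr !scalerA (mulrC sigma^-1) addrACA.
Qed.

HB.instance Definition _ := GRing.isLinear.Build R (Y * Z * X)%type
  (Y * Z * X)%type *:%R M Mop_linear.

Hypotheses (hA : adjoint_of A As).

Lemma Mop_self_adjoint :
  self_adjoint inner Pf -> self_adjoint inner Pg -> self_adjoint (@innerH R Y Z X) M.
Proof.
move=> Pf_sa Pg_sa u v; rewrite /innerH /Mop /=.
rewrite !linearDl !linearDr !linearZl_LR !linearZr_LR /= Pf_sa Pg_sa.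
rewrite !(innerC (As _)) -!hA (innerC (A v.1.1) (A _)) (innerC u.2 (A _)).
ring.
Qed.

(* The part of the form outside Pf and Pg is the square
   sigma |A y + sigma^-1 x|^2. *)
Lemma Mop_psd : 0 < sigma ->
  psd inner Pf -> psd inner Pg -> psd (@innerH R Y Z X) M.
Proof.
move=> s0 Pf0 Pg0 w.
have -> : normsq (@innerH R Y Z X) M w =
    normsq inner Pf w.1.1 + normsq inner Pg w.1.2 +
    sigma * inner (A w.1.1 + sigma^-1 *: w.2) (A w.1.1 + sigma^-1 *: w.2).
  rewrite /normsq /innerH /Mop /=.
  rewrite !linearDl !linearDr !linearZl_LR !linearZr_LR /= -!hA.
  by rewrite (innerC (A w.1.1) w.2) /GRing.scale /=; field; rewrite gt_eqF.
by rewrite !addr_ge0 // mulr_ge0 ?(ltW s0) // -inner_normE sqr_ge0.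
Qed.

End MetricOperator.

Theorem proposition3p5 (R : realType) (Y Z X : euclideanType R)
  (p : Y -> \bar R) (q : Z -> \bar R) (f : Y -> R) (g : Z -> R)
  (gradf : Y -> Y) (gradg : Z -> Z)
  (A : 'Hom(Y, X)) (B : 'Hom(Z, X)) (As : 'Hom(X, Y)) (Bs : 'Hom(X, Z)) (c : X)
  (Sigmaf calS : 'End(Y)) (Sigmag calT : 'End(Z)) (sigma : R)
  (hp : closed_proper_convex p) (hq : closed_proper_convex q)
  (hf : convex_function setT f) (hg : convex_function setT g)
  (hgradf : has_gradient f gradf) (hgradg : has_gradient g gradg)
  (hLf : lipschitz gradf) (hLg : lipschitz gradg)
  (hAs : adjoint_of A As) (hBs : adjoint_of B Bs)
  (hSigmaf : self_adjoint inner Sigmaf) (hSigmaf0 : psd inner Sigmaf)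
  (hSigmag : self_adjoint inner Sigmag) (hSigmag0 : psd inner Sigmag)
  (hmajf : majorized f gradf Sigmaf) (hmajg : majorized g gradg Sigmag)
  (hsigma : 0 < sigma)
  (hS : self_adjoint inner calS) (hT : self_adjoint inner calT) :
  let Pf := calS + Sigmaf in
  let Pg := calT + Sigmag in
  let rns := Rns p q A B As Bs c in
  let fsm := Fsm gradf gradg in
  let M := Mop sigma Pf Pg A As in
  forall (Mdag : 'End((Y * Z * X)%type)) (T : Y * Z * X -> Y * Z * X),
  moore_penrose innerH M Mdag ->
  is_mapping_T M rns fsm T ->
  kkt_set rns fsm !=set0 ->
  psd inner Pf -> psd inner Pg ->
  posdef inner (Pf + sigma *: (As \o A)%VF) ->
  posdef inner (Pg + sigma *: (Bs \o B)%VF) ->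
  forall beta : R, 0 < beta <= 1 ->
  (forall w1 w2 : Y * Z * X,
     let dw := w1 - w2 in
     let dF := fsm w1 - fsm w2 in
     range M dF /\ (2 * beta)^-1 * normsq innerH Mdag dF <= innerH dF dw) ->
  (forall w1 w2 : Y * Z * X,
     normsq innerH M (T w1 - T w2) <=
       normsq innerH M (w1 - w2)
       - (1 - beta) * normsq innerH M ((w1 - T w1) - (w2 - T w2))) /\
  (forall w1 w2 : Y * Z * X,
     seminorm innerH M (T w1 - T w2) <= seminorm innerH M (w1 - w2)).
Proof.
move=> Pf Pg rns fsm M Mdag T hMdag hT0 _ Pf0 Pg0 _ _ b /andP[b0 b1] coco.
have Pf_sa : self_adjoint inner Pf.
  by move=> u v; rewrite !add_lfunE linearDl linearDr /= hS hSigmaf.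
have Pg_sa : self_adjoint inner Pg.
  by move=> u v; rewrite !add_lfunE linearDl linearDr /= hT hSigmag.
have M_sa := Mop_self_adjoint sigma hAs Pf_sa Pg_sa.
have M_psd := Mop_psd hAs hsigma Pf0 Pg0.
have contr w1 w2 : normsq innerH M (T w1 - T w2) <=
    normsq innerH M (w1 - w2)
    - (1 - b) * normsq innerH M ((w1 - T w1) - (w2 - T w2)).
  have [imF cocoF] := coco w1 w2.
  have -> : w1 - T w1 - (w2 - T w2) = w1 - w2 - (T w1 - T w2) by exact: subrACA.
  apply: (cocoercive_step_contraction innerHC M_sa M_psd hMdag b0 imF cocoF).
  (* Each r_i lies in [rns (T w_i)] and equals M w_i - fsm w_i - M (T w_i), so r1 - r2 is M (d - d')
     - D and monotonicity at [T w1], [T w2] is the remaining premise. *)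
  have [[r1 Rr1 e1] [r2 Rr2 e2]] := (hT0 w1, hT0 w2).
  have [[_ pp _] [_ pq _]] := (hp, hq).
  have := Rns_monotone pp pq hAs hBs Rr1 Rr2.
  suff -> : r1 - r2 = Mop sigma Pf Pg A As (w1 - w2 - (T w1 - T w2))
                      - (fsm w1 - fsm w2) by [].
  have {e1}-> : r1 = M w1 - fsm w1 - M (T w1) by rewrite -e1 addrC addKr.
  have {e2}-> : r2 = M w2 - fsm w2 - M (T w2) by rewrite -e2 addrC addKr.
  have MB u v : M (u - v) = M u - M v by exact: linearB.
  by rewrite -/M !MB (subrACA (_ - _)) (subrACA (M w1)) addrAC.
(* Nonexpansiveness: the subtracted term is nonnegative since b <= 1 and [M] is semidefinite; at b =
   1 it vanishes. *)
split=> // w1 w2; rewrite ler_wsqrtr // (le_trans (contr w1 w2)) //.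
by rewrite gerBl mulr_ge0 ?subr_ge0 //; exact: M_psd.
Qed.
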